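(* Let $p$ be a prime and $\mathbb{K}=\mathbb{F}_p$. Then there exists an integer $n_0$ such that, for every integer $n\geq n_0$, every matrix of $\mathrm{M}_n(\mathbb{K})$ is a sum of $4$ idempotent matrices of $\mathrm{M}_n(\mathbb{K})$.
   Context: An idempotent matrix is a matrix $Q\in \mathrm{M}_n(\mathbb{K})$ with $Q^2=Q$ (the zero matrix and the identity matrix are idempotents). *)

(* Defs.v *)
From mathcomp Require Import all_boot all_order all_algebra.

Set Implicit Arguments.
Unset Strict Implicit.
Unset Printing Implicit Defensive.

Import GRing.Theory.
Local Open Scope ring_scope.

Definition idempotent_mx (K : fieldType) (n : nat) (Q : 'M[K]_n) : Prop :=
  Q *m Q = Q.

(* The k summands need not be distinct, and may be zero. *)
Definition sum_of_idempotents (K : fieldType) (n k : nat) (A : 'M[K]_n) : Prop :=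
  exists Q : 'I_k -> 'M[K]_n,
    (forall i, idempotent_mx (Q i)) /\ A = \sum_(i < k) Q i.

(* Main.v *)
Require Import Defs.
From mathcomp Require Import all_boot all_order all_algebra.
From mathcomp Require Import zify ring.

(* For every nilpotent N, 1 + N is a sum of two idempotents: along a Jordan
   chain, the projector E on every second vector satisfies NE + EN = N, and
   1 + N = (E + (1-E)NE) + (1 - E + EN(1-E)). Hence a matrix with all diagonal
   entries 2 is a sum of four idempotents (split it into its two triangular
   halves), and by Fillmore's theorem so is any nonscalar A with tr A = 2n. The
   other traces require some diagonal entries 3 = 2 + 1, and the summand with
   eigenvalue 2 has to be controlled.
   - If A is far from every scalar matrix, A is similar to a matrix with a
     diagonal block 3I of size j for the required j, the other diagonal entries
     being 2; the eigenvalue 2 is then semisimple in the first summand.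
   - If A is a low rank perturbation of the scalar lambda, a block lambda I_m
     splits off. When lambda <> 2, the size m can be chosen so that the rest
     has the right trace, and lambda I_m is handled by a chain of eigenvalues
     that is closed by the characteristic. When lambda = 2, the block 2I_m is
     written (1+Y) + (1-Y), where Y compensates the Jordan blocks of the
     eigenvalue 2 in the first summand of the rest. *)

Section SumsOfIdempotents.

Import GRing.Theory.
Local Open Scope ring_scope.
Local Set Implicit Arguments.
Local Unset Strict Implicit.

Implicit Type F : fieldType.

(** * Similarity, and sums of two or four idempotents *)

Definition sim F n (A B : 'M[F]_n) : Prop :=
  exists2 g, g \in unitmx & g *m A = B *m g.

Definition sum2 F n (A : 'M[F]_n) : Prop :=
  exists P Q : 'M[F]_n, [/\ P *m P = P, Q *m Q = Q & A = P + Q].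

Definition sum4 F n (A : 'M[F]_n) : Prop :=
  exists B C : 'M[F]_n, [/\ sum2 B, sum2 C & A = B + C].

Lemma sim_refl F n (A : 'M[F]_n) : sim A A.
Proof. by exists 1%:M; rewrite ?unitmx1 // mul1mx mulmx1. Qed.

Lemma sim_sym F n (A B : 'M[F]_n) : sim A B -> sim B A.
Proof.
case=> g gu e; exists (invmx g); rewrite ?unitmx_inv //.
by rewrite -[LHS](mulmxK gu) -(mulmxA _ B) -e mulmxA mulVmx // mul1mx.
Qed.

Lemma sim_trans F n (A B C : 'M[F]_n) : sim A B -> sim B C -> sim A C.
Proof.
move=> [g gu e] [h hu e']; exists (h *m g); first by rewrite unitmx_mul hu.
by rewrite -mulmxA e mulmxA e' mulmxA.
Qed.

Lemma sim_block F n m (A A' : 'M[F]_n) (B B' : 'M[F]_m) :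
  sim A A' -> sim B B' -> sim (block_mx A 0 0 B) (block_mx A' 0 0 B').
Proof.
move=> [g gu e] [h hu e']; exists (block_mx g 0 0 h).
  by rewrite block_diag_mx_unit gu.
by rewrite !mulmx_block !mul0mx !mulmx0 !addr0 !add0r e e'.
Qed.

Lemma mxtrace_sim F n (A B : 'M[F]_n) : sim A B -> \tr A = \tr B.
Proof.
case=> g gu e; have -> : A = invmx g *m (B *m g) by rewrite -e mulKmx.
by rewrite mxtrace_mulC mulmxK.
Qed.

(** Rectangular [g] and [h] are allowed so that the swap of two diagonal blocks, between the equal
    but not convertible sizes [n + m] and [m + n], needs no cast. *)
Lemma sum2_conj F n m (g : 'M[F]_(m, n)) (h : 'M[F]_(n, m)) (A : 'M[F]_n) :
  h *m g = 1%:M -> sum2 A -> sum2 (g *m A *m h).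
Proof.
move=> hg [P [Q [eP eQ ->]]].
have idc (E : 'M[F]_n) : E *m E = E ->
    (g *m E *m h) *m (g *m E *m h) = g *m E *m h.
  by move=> eE; rewrite -!mulmxA (mulmxA h) hg mul1mx (mulmxA E E) eE.
exists (g *m P *m h), (g *m Q *m h).
by split; [exact: idc | exact: idc | rewrite -mulmxDl -mulmxDr].
Qed.

Lemma sum2_sim F n (A B : 'M[F]_n) : sim A B -> sum2 A -> sum2 B.
Proof.
by move=> [g gu e] /(sum2_conj (mulVmx gu)); rewrite e mulmxK.
Qed.

Lemma sum4_sim F n (A B : 'M[F]_n) : sim A B -> sum4 A -> sum4 B.
Proof.
move=> [g gu e] [C [D [sC sD eA]]].
have sc (E : 'M[F]_n) := @sum2_conj F n n g (invmx g) E (mulVmx gu).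
exists (g *m C *m invmx g), (g *m D *m invmx g).
by split; [exact: sc | exact: sc | rewrite -mulmxDl -mulmxDr -eA e mulmxK].
Qed.

Lemma sum2_block F n m (A : 'M[F]_n) (B : 'M[F]_m) :
  sum2 A -> sum2 B -> sum2 (block_mx A 0 0 B).
Proof.
move=> [P [Q [eP eQ ->]]] [P' [Q' [eP' eQ' ->]]].
exists (block_mx P 0 0 P'), (block_mx Q 0 0 Q').
by split; rewrite ?add_block_mx ?mulmx_block ?mul0mx ?mulmx0 ?addr0 ?add0r
  ?eP ?eQ ?eP' ?eQ'.
Qed.

Lemma sum4_block F n m (A : 'M[F]_n) (B : 'M[F]_m) :
  sum4 A -> sum4 B -> sum4 (block_mx A 0 0 B).
Proof.
move=> [P [Q [sP sQ ->]]] [P' [Q' [sP' sQ' ->]]].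
exists (block_mx P 0 0 P'), (block_mx Q 0 0 Q').
by split; rewrite ?add_block_mx ?addr0 //; apply: sum2_block.
Qed.

Lemma sum2_castmx F n m (e : n = m) (A : 'M[F]_n) :
  sum2 A -> sum2 (castmx (e, e) A).
Proof. by case: m / e; rewrite castmx_id. Qed.

Lemma sum2_blockC F n m (A : 'M[F]_n) (B : 'M[F]_m) :
  sum2 (block_mx A 0 0 B) -> sum2 (block_mx B 0 0 A).
Proof.
have e : block_mx 0 1%:M 1%:M 0 *m block_mx 0 1%:M 1%:M 0 = 1%:M :> 'M[F]_(n +
  m).
  by rewrite mulmx_block !mulmx0 !mul0mx !mul1mx ?addr0 ?add0r -scalar_mx_block.
move/(sum2_conj e); rewrite !mulmx_block.
by rewrite !(mulmx0, mul0mx, mul1mx, mulmx1, addr0, add0r).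
Qed.

Lemma sum2_blockA F n m k (A : 'M[F]_n) (B : 'M[F]_m) (C : 'M[F]_k) :
  sum2 (block_mx A 0 0 B) -> sum2 C ->
  sum2 (block_mx A 0 0 (block_mx B 0 0 C)).
Proof.
move=> sAB sC; have := @block_mxA F n m k n m k A 0 0 0 B 0 0 0 C.
by rewrite /= !row_mx0 !col_mx0 => ->; apply/sum2_castmx/sum2_block.
Qed.

(** * Nilpotent matrices and their Jordan chains *)

Definition nilmx F n (N : 'M[F]_n) : Prop := exists k, N ^+ k = 0.

(** A Jordan chain of maximal length is split off inside the range of [Pi]. If [k.+1] is the least
    exponent with [N ^+ k.+1 *m Pi = 0], a row [x] and a column [phi] fixed by [Pi] with
    [x N^k phi = 1] generate dual chains. [Rho] is the resulting projector onto the chain, and [E]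
    keeps every second vector of it. *)
Lemma jordan_block_grading F n (N Pi : 'M[F]_n) :
  nilmx N -> Pi *m Pi = Pi -> Pi *m N = N *m Pi -> Pi != 0 ->
  exists Rho E : 'M[F]_n,
    [/\ Rho *m Rho = Rho, Rho *m N = N *m Rho, Rho *m Pi = Rho,
        Pi *m Rho = Rho & Rho != 0]
    /\ [/\ E *m E = E, E *m Rho = E, Rho *m E = E & N *m E + E *m N = N *m Rho].
Proof.
move=> [k0 Nk0] Pi2 cPi Pi0.
have cPiX k : Pi *m N ^+ k = N ^+ k *m Pi.
  elim: k => [|k IH]; first by rewrite expr0 mulmx1 mul1mx.
  by rewrite exprS -mulmxE mulmxA cPi -!mulmxA IH.
have ex : exists k, N ^+ k *m Pi == 0 by exists k0; rewrite Nk0 mul0mx.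
case: (ex_minnP ex) => -[|k] /eqP Nk1 kmin.
  by move: Pi0; rewrite -[Pi]mul1mx Nk1 eqxx.
have /matrix0Pn[i [j nz]]: N ^+ k *m Pi != 0.
  by apply/negP=> /kmin; rewrite ltnn.
pose c := ((N ^+ k *m Pi) i j)^-1.
pose x : 'rV[F]_n := c *: row i Pi; pose phi : 'cV[F]_n := col j Pi.
have xPi : x *m Pi = x by rewrite -scalemxAl -row_mul Pi2.
have Piphi : Pi *m phi = phi by rewrite /phi colE mulmxA Pi2.
have xN m : (k < m)%N -> x *m N ^+ m = 0.
  move=> h; rewrite -xPi -mulmxA cPiX -(subnK h) exprD -mulmxE.
  by rewrite -[_ *m Pi]mulmxA Nk1 !mulmx0.
have Nphi m : (k < m)%N -> N ^+ m *m phi = 0.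
  by move=> /subnK <-; rewrite exprD -mulmxE -Piphi -!mulmxA (mulmxA _ Pi) Nk1
    mul0mx mulmx0.
have xNphi : x *m N ^+ k *m phi = 1%:M.
  apply/matrixP=> a b; rewrite !ord1 !mxE eqxx.
  have -> : \sum_j0 (x *m N ^+ k) 0 j0 * phi j0 0 = c * (Pi *m N ^+ k *m Pi) i
    j.
    rewrite -scalemxAl -row_mul mxE mulr_sumr; apply: eq_bigr => l _.
    by rewrite !mxE mulrA.
  by rewrite cPiX -mulmxA Pi2 /c mulVf.
(* Indexing the rows by [k - a] makes [N] act on [X] and on [Phi] through the same shift [S], and
   makes the pairing [X *m Phi] lower triangular with unit diagonal. *)
pose X : 'M[F]_(k.+1, n) := \matrix_(a < k.+1) (x *m N ^+ (k - a)).
pose Phi : 'M[F]_(n, k.+1) := \matrix_(l < n, b < k.+1) (N ^+ b *m phi) l 0.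
pose S : 'M[F]_k.+1 := \matrix_(a, b) (a == b.+1 :> nat)%:R.
pose D : 'M[F]_k.+1 := diag_mx (\row_a (odd a)%:R).
(* The shift links only indices of opposite parity, so exactly one of the two products keeps each of
   its entries. *)
have ES : D *m S + S *m D = S.
  apply/matrixP=> a b; rewrite mxE mul_diag_mx mul_mx_diag !mxE.
  by case: eqP => [->|_]; rewrite ?mulr0 ?mul0r ?addr0 //= mul1r mulr1; case:
    odd; rewrite ?addr0 ?add0r.
have EX : X *m N = S *m X.
  apply/row_matrixP=> a; rewrite !row_mul rowK -mulmxA.
  rewrite mulmxE -exprSr; case: a => -[|a] ha.
    rewrite xN ?subn0 //; symmetry; apply/rowP=> l; rewrite !mxE big1 // => b _.
    by rewrite !mxE mul0r.
  have la : (a < k.+1)%N by apply: ltnW.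
  transitivity (row (Ordinal la) X); first by rewrite rowK /= subnSK //.
  rewrite [LHS]rowE; congr (_ *m _); apply/rowP=> b; rewrite !mxE /=.
  by rewrite eqSS -(inj_eq val_inj) /= eq_sym.
have EPhi : N *m Phi = Phi *m S.
  apply/matrixP=> l b; rewrite !mxE.
  have -> : \sum_j0 N l j0 * Phi j0 b = (N ^+ b.+1 *m phi) l 0.
    by rewrite exprS -mulmxE -mulmxA mxE; apply: eq_bigr => q _; rewrite !mxE.
  case: (ltnP b.+1 k.+1) => hb.
    rewrite (bigD1 (Ordinal hb)) //= big1 ?addr0 => [|q qb].
      by rewrite !mxE eqxx mulr1.
    rewrite !mxE; case: eqP => [e|]; last by rewrite mulr0.
    by case/eqP: qb; apply: val_inj.
  rewrite Nphi // mxE big1 // => q _; rewrite !mxE.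
  by case: eqP => [e|]; [move: (ltn_ord q); rewrite e ltnNge hb | rewrite
    mulr0].
pose M := X *m Phi.
have EM (a b : 'I_k.+1) : M a b = (x *m N ^+ (k - a + b) *m phi) 0 0.
  rewrite exprD -mulmxE mulmxA -[_ *m phi]mulmxA [LHS]mxE [RHS]mxE.
  by apply: eq_bigr => l _; rewrite !mxE.
have Mu : M \in unitmx.
  rewrite unitmxE det_trig.
    rewrite big1 ?unitr1 // => a _.
    by rewrite EM subnK -1?ltnS // xNphi mxE.
  apply/is_trig_mxP => a b lab; rewrite EM xN ?mul0mx ?mxE //.
  by have := ltn_ord a; rewrite ltnS; lia.
have cSM : S *m invmx M = invmx M *m S.
  have e : S *m M = M *m S by rewrite /M mulmxA -EX -!mulmxA EPhi.
  by rewrite -[LHS](mulKmx Mu) (mulmxA M) -e mulmxK.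
have XPi : X *m Pi = X.
  apply/row_matrixP=> a; rewrite row_mul rowK -mulmxA -cPiX mulmxA xPi //.
have PiPhi : Pi *m Phi = Phi.
  apply/matrixP=> l b; transitivity ((Pi *m (N ^+ b *m phi)) l 0).
    by rewrite [LHS]mxE [RHS]mxE; apply: eq_bigr => q _; rewrite [Phi _ _]mxE.
  by rewrite mulmxA cPiX -mulmxA Piphi [RHS]mxE.
(* [G] is multiplicative and carries [S] to [N], which reduces all identities to square matrices of
   size [k.+1]. *)
pose G (T : 'M[F]_k.+1) := Phi *m invmx M *m T *m X.
have GG T U : G T *m G U = G (T *m U).
  by rewrite /G -!mulmxA (mulmxA X) mulKVmx.
have NG T : N *m G T = G (S *m T) by rewrite /G !mulmxA EPhi -(mulmxA Phi) cSM
  mulmxA.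
have GN T : G T *m N = G (T *m S) by rewrite /G -!mulmxA EX.
have GPi T : G T *m Pi = G T by rewrite /G -!mulmxA XPi.
have PiG T : Pi *m G T = G T by rewrite /G !mulmxA PiPhi.
exists (G 1%:M), (G D); split; split; rewrite ?GG ?NG ?GN ?GPi ?PiG ?mul1mx
  ?mulmx1 //.
- apply: (contraTneq _ Mu) => e; have <-: X *m G 1%:M *m Phi = M.
    by rewrite /G mulmx1 -!mulmxA mulVmx // mulmx1.
  by rewrite e mulmx0 mul0mx unitr0.
- congr G; apply/matrixP=> a b; rewrite mul_diag_mx !mxE.
  by case: (odd a); rewrite /= ?mul1r ?mul0r ?mul0rn.
- by rewrite addrC -[in RHS]ES /G mulmxDr mulmxDl.
Qed.

(** Induction on the rank of [Pi]: one chain is peeled off and the projectors [E] of the pieces add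
    up. Keeping [Pi] general lets the induction run without changing the matrix size. *)
Lemma nilmx_grading_in F n (N Pi : 'M[F]_n) :
  nilmx N -> Pi *m Pi = Pi -> Pi *m N = N *m Pi ->
  exists E : 'M[F]_n,
    [/\ E *m E = E, E *m Pi = E, Pi *m E = E & N *m E + E *m N = N *m Pi].
Proof.
move=> nN; have [r] := ubnP (\rank Pi).
elim: r Pi => // r IH Pi rPi Pi2 cPi.
have [->|Pi0] := eqVneq Pi 0.
  by exists 0; rewrite !(mulmx0, mul0mx) addr0.
have [Rho [E1 [[R2 cR RPi PiR R0] [E2 ER RE NE]]]] :=
  jordan_block_grading nN Pi2 cPi Pi0.
have [|||E' [E'2 E'P PE' NE']] := IH (Pi - Rho).
- rewrite ltnS in rPi; apply: leq_trans rPi; apply: rank_ltmx.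
  rewrite ltmxE; apply/andP; split.
    by apply/submxP; exists (Pi - Rho); rewrite mulmxBl Pi2 RPi.
  apply/negP=> /submxP[B e]; case/eqP: R0.
  by rewrite -PiR e -mulmxA mulmxBl PiR R2 subrr mulmx0.
- by rewrite mulmxBl !mulmxBr Pi2 RPi PiR R2 subrr subr0.
- by rewrite mulmxBl mulmxBr cPi cR.
have E1E' : E1 *m E' = 0.
  by rewrite -PE' -ER mulmxA -(mulmxA E1) mulmxBr RPi R2 subrr mulmx0 mul0mx.
have E'E1 : E' *m E1 = 0.
  by rewrite -E'P -RE mulmxA -(mulmxA E') mulmxBl PiR R2 subrr mulmx0 mul0mx.
exists (E1 + E'); split.
- by rewrite mulmxDl !mulmxDr E2 E1E' E'E1 E'2 addr0 add0r.
- rewrite mulmxDl -{1}ER -mulmxA RPi ER.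
  by congr (_ + _); rewrite -{1}E'P -mulmxA mulmxBl Pi2 RPi E'P.
- rewrite mulmxDr -{1}RE mulmxA PiR RE.
  by congr (_ + _); rewrite -{1}PE' mulmxA mulmxBr Pi2 PiR PE'.
- by rewrite mulmxDr mulmxDl addrACA NE NE' mulmxBr addrC subrK.
Qed.

(** Relative to the decomposition given by [E], the matrix [N] is off-diagonal. Each of its two
    off-diagonal parts can be added to one of the complementary projectors without spoiling
    idempotence. *)
Lemma sum2_unipotent F n (N : 'M[F]_n) : nilmx N -> sum2 (1%:M + N).
Proof.
move=> nN.
have [||E [E2 _ _]] := @nilmx_grading_in F n N 1%:M nN.
- by rewrite mulmx1.
- by rewrite mulmx1 mul1mx.
rewrite mulmx1 => NE.
have ENE : E *m N *m E = 0.
  apply: (addrI (E *m N)); rewrite addr0 -[in RHS]NE mulmxDr !mulmxA E2.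
  by rewrite addrC.
pose E' := 1%:M - E.
have EE' : E *m E' = 0 by rewrite mulmxBr mulmx1 E2 subrr.
have E'E : E' *m E = 0 by rewrite mulmxBl mul1mx E2 subrr.
have E'2 : E' *m E' = E' by rewrite {2}/E' mulmxBr mulmx1 E'E subr0.
have dE' : E' = 1%:M - E by [].
clearbody E'; exists (E + E' *m N *m E), (E' + E *m N *m E'); split.
- rewrite mulmxDl !mulmxDr E2 !mulmxA EE' !mul0mx addr0 -!mulmxA E2.
  by rewrite (mulmxA E E') EE' mul0mx !mulmx0 addr0.
- rewrite mulmxDl !mulmxDr E'2 !mulmxA E'E !mul0mx addr0 -!mulmxA E'2.
  by rewrite (mulmxA E' E) E'E mul0mx !mulmx0 addr0.
- rewrite addrACA {1}dE' (addrC E) subrK dE' !mulmxBl mulmxBr mul1mx ENE mulmx1.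
  by rewrite !subr0 NE.
Qed.

(** * Sylvester equations, nilpotent and triangular matrices *)

Lemma sylvester_nilmx F m n (A : 'M[F]_m) (N : 'M[F]_n) (C : 'M[F]_(m, n)) :
  A \in unitmx -> nilmx N -> exists Y, A *m Y - Y *m N = C.
Proof.
move=> uA [k Nk]; have {Nk}: C *m N ^+ k = 0 by rewrite Nk mulmx0.
elim: k C => [|k IH] C.
  by rewrite expr0 mulmx1 => ->; exists 0; rewrite mulmx0 mul0mx subr0.
rewrite exprS -mulmxE mulmxA => e.
have [|Y eY] := IH (invmx A *m C *m N); first by rewrite -!mulmxA (mulmxA C) e
  mulmx0.
(* The first term leaves the error [invmx A *m C *m N], killed by one power of [N] less; the full
   solution is a finite Neumann series. *)
exists (invmx A *m C + Y); rewrite mulmxDr mulmxDl mulKVmx //.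
by rewrite opprD addrACA eY subrK.
Qed.

(** On the left kernel of [a + N], the nilpotent [N] would act as the nonzero scalar [- a]. *)
Lemma unitmx_scalar_nil F n (a : F) (N : 'M[F]_n) :
  a != 0 -> nilmx N -> a%:M + N \in unitmx.
Proof.
move=> a0 [k Nk]; rewrite -row_free_unit -kermx_eq0; apply/eqP.
set K := kermx _; have: K *m (a%:M + N) = 0 by apply: mulmx_ker.
rewrite mulmxDr mul_mx_scalar => /(canRL (addrK _)); rewrite sub0r => e.
have: K *m N ^+ k = 0 by rewrite Nk mulmx0.
elim: k {Nk} => [|k IH]; first by rewrite expr0 mulmx1.
rewrite exprS -mulmxE mulmxA -[K *m N]opprK -e mulNmx -scalemxAl.
by move/eqP; rewrite oppr_eq0 scaler_eq0 (negPf a0) => /eqP.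
Qed.

Lemma nilmxN F n (N : 'M[F]_n) : nilmx N -> nilmx (- N).
Proof. by case=> k e; exists k; rewrite exprNn e mulr0. Qed.

Lemma nilmx_block F m n (N : 'M[F]_m) (W : 'M[F]_(m, n)) (N' : 'M[F]_n) :
  nilmx N -> nilmx N' -> nilmx (block_mx N W 0 N').
Proof.
move=> [a ea] [b eb]; exists (a + b)%N.
have ex k : exists V, block_mx N W 0 N' ^+ k = block_mx (N ^+ k) V 0 (N' ^+ k).
  elim: k => [|k [V e]]; first by exists 0; rewrite !expr0 -scalar_mx_block.
  by exists (N *m V + W *m N' ^+ k); rewrite !exprS e -!mulmxE mulmx_block
    !(mul0mx, mulmx0, addr0, add0r).
have [[V eV] [V' eV']] := (ex a, ex b).
rewrite exprD eV eV' ea eb -mulmxE mulmx_block.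
by rewrite !(mul0mx, mulmx0, addr0) block_mx0.
Qed.

Definition strictly_lower F n (N : 'M[F]_n) : Prop :=
  forall i j : 'I_n, (i <= j)%N -> N i j = 0.

Lemma strictly_lower_nilmx F n (N : 'M[F]_n) : strictly_lower N -> nilmx N.
Proof.
move=> sN; exists n.
have H k : forall i j : 'I_n, (i < j + k)%N -> (N ^+ k) i j = 0.
  elim: k => [|k IH] i j.
    by rewrite addn0 expr0 mxE => /ltn_eqF; rewrite -val_eqE /= => ->.
  rewrite exprS -mulmxE mxE => lij; apply: big1 => l _.
  case: (leqP i l) => il; first by rewrite sN ?mul0r.
  by rewrite IH ?mulr0 //; lia.
by apply/matrixP=> i j; rewrite H ?mxE // ltn_addl.
Qed.

Lemma nilmx_tr F n (N : 'M[F]_n) : nilmx N -> nilmx N^T.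
Proof.
case=> k e; exists k; apply: trmx_inj; rewrite trmx0 -e {e}.
elim: k => [|k IH]; first by rewrite !expr0 trmx1.
by rewrite exprS exprSr -mulmxE trmx_mul IH trmxK.
Qed.

Definition lower_part F n (A : 'M[F]_n) : 'M[F]_n :=
  \matrix_(i, j) if (j < i)%N then A i j else 0.

Lemma strictly_lower_lower_part F n (A : 'M[F]_n) : strictly_lower (lower_part
  A).
Proof. by move=> i j ij; rewrite mxE ltnNge ij. Qed.

Lemma nilmx_lower_part F n (A : 'M[F]_n) : nilmx (lower_part A).
Proof. exact/strictly_lower_nilmx/strictly_lower_lower_part. Qed.

Lemma nilmx_upper_part F n (A : 'M[F]_n) : nilmx (lower_part A^T)^T.
Proof. exact/nilmx_tr/nilmx_lower_part. Qed.

Lemma eq_lower_upper F n (A : 'M[F]_n) (a b : F) :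
  (forall i, A i i = a + b) -> A = (a%:M + lower_part A) + (b%:M + (lower_part
    A^T)^T).
Proof.
move=> dA; apply/matrixP=> i j; rewrite !mxE -val_eqE /=.
case: ltngtP => [_|_|/val_inj <-].
- by rewrite !mulr0n add0r !addr0.
- by rewrite !mulr0n !add0r.
- by rewrite dA !addr0.
Qed.

Lemma sim_ltriangle F m n (A : 'M[F]_m) (B : 'M[F]_n) (C : 'M[F]_(n, m)) :
  (exists Y, B *m Y - Y *m A = C) -> sim (block_mx A 0 C B) (block_mx A 0 0 B).
Proof.
case=> Y e; exists (block_mx 1%:M 0 Y 1%:M).
  by rewrite unitmxE det_lblock !det1 mulr1 unitr1.
by rewrite !mulmx_block !(mul0mx, mulmx0, mul1mx, mulmx1, addr0, add0r) -e
  addrC subrK.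
Qed.

Lemma sim_utriangle F m n (A : 'M[F]_m) (B : 'M[F]_n) (C : 'M[F]_(m, n)) :
  (exists Y, A *m Y - Y *m B = C) -> sim (block_mx A C 0 B) (block_mx A 0 0 B).
Proof.
case=> Y e; exists (block_mx 1%:M Y 0 1%:M).
  by rewrite unitmxE det_ublock !det1 mulr1 unitr1.
by rewrite !mulmx_block !(mul0mx, mulmx0, mul1mx, mulmx1, addr0, add0r) -e
  subrK.
Qed.

(** * Nonscalar matrices and prescribed diagonals *)

Lemma row_free_ker F m n (U : 'M[F]_(m, n)) :
  (forall v : 'rV_m, v *m U = 0 -> v = 0) -> row_free U.
Proof.
move=> H; rewrite -kermx_eq0; apply/eqP/row_matrixP => i; rewrite row0.
by apply: H; rewrite -row_mul mulmx_ker row0.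
Qed.

(** The first [k] rows of the invertible [row_ebase U] span the rows of [U], so its last [m] rows
    complete them. *)
Lemma row_free_complete F k m (U : 'M[F]_(k, k + m)) :
  row_free U -> exists C : 'M_(m, k + m), col_mx U C \in unitmx.
Proof.
move=> /eqP rU; exists (dsubmx (row_ebase U)).
suff -> : col_mx U (dsubmx (row_ebase U)) =
          block_mx (col_ebase U) 0 0 1%:M *m row_ebase U.
  by rewrite unitmx_mul row_ebase_unit block_diag_mx_unit col_ebase_unit
    unitmx1.
rewrite -[in RHS](vsubmxK (row_ebase U)) mul_block_col !mul0mx mul1mx addr0
  add0r.
congr col_mx; rewrite -[LHS]mulmx_ebase rU pid_mx_row -mulmxA; congr (_ *m _).
by rewrite -{1}(vsubmxK (row_ebase U)) mul_row_col mul1mx mul0mx addr0.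
Qed.

Lemma row_free2 F n (x y : 'rV[F]_n) :
  x != 0 -> (forall c, y != c *: x) -> row_free (col_mx x y).
Proof.
move=> x0 H; apply: row_free_ker => v.
rewrite -[v]hsubmxK mul_row_col.
rewrite [lsubmx v]mx11_scalar [rsubmx v]mx11_scalar !mul_scalar_mx.
set a := lsubmx v 0 0; set b := rsubmx v 0 0 => e.
have b0 : b = 0.
  apply/eqP/negP=> /negP nb; case/eqP: (H (- (a / b))).
  apply: (scalerI nb); rewrite scalerA mulrN mulrC divfK // scaleNr.
  by apply/eqP; rewrite -addr_eq0 addrC e.
move/eqP: e; rewrite b0 scale0r addr0 scaler_eq0 (negPf x0) orbF => /eqP ->.
by rewrite !raddf0 row_mx0.
Qed.

(** A matrix for which every vector is an eigenvector is scalar. Basis vectors detect an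
    off-diagonal entry, and sums of two of them detect unequal diagonal entries. *)
Lemma nonscalar_vector F n (A : 'M[F]_n) :
  ~~ is_scalar_mx A -> exists x : 'rV_n, row_free (col_mx x (x *m A)).
Proof.
move=> nA.
have [/existsP[i /existsP[j /andP[ij nz]]]|/existsPn offd] :=
  boolP [exists i, [exists j, (i != j) && (A i j != 0)]].
  exists (delta_mx 0 i); apply: row_free2 => [|c].
    by apply/matrix0Pn; exists 0, i; rewrite mxE !eqxx oner_eq0.
  rewrite -rowE; apply: contraNneq nz => /matrixP/(_ 0 j).
  by rewrite !mxE [j == i]eq_sym (negPf ij) andbF mulr0 => ->.
have off i j : i != j -> A i j = 0.
  move=> ij; move/existsPn/(_ j): (offd i); rewrite ij /= negbK.
  by move/eqP.
have [/existsP[i /existsP[j nz]]|/existsPn eqd] :=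
  boolP [exists i, [exists j, A i i != A j j]].
  have ij : i != j by apply: contraNneq nz => ->.
  exists (delta_mx 0 i + delta_mx 0 j); apply: row_free2 => [|c].
    apply/matrix0Pn; exists 0, i.
    by rewrite !mxE !eqxx (negPf ij) /= addr0 oner_eq0.
  rewrite mulmxDl -!rowE; apply: contraNneq nz => /matrixP e.
  have := e 0 i; have := e 0 j.
  rewrite !mxE !eqxx [j == i]eq_sym (negPf ij) /= add0r addr0 mulr1.
  by rewrite (off _ _ ij) add0r (off j i) 1?eq_sym // addr0 => -> ->.
case/negP: nA; case: n A {offd} off eqd => [|n] A off eqd.
  by apply/is_scalar_mxP; exists 0; apply/matrixP=> -[].
apply/is_scalar_mxP; exists (A 0 0); apply/matrixP=> i j; rewrite mxE.
have [<-|ij] := eqVneq i j; last by rewrite (off _ _ ij).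
by move/existsPn/(_ 0): (eqd i); rewrite negbK => /eqP.
Qed.

(** In a basis that starts with the rows of [Y], the upper right block is the part of [Y *m A]
    outside the span of [Y]. *)
Lemma sim_ur_row_free F k m (A : 'M[F]_(k + m)) (Y : 'M[F]_(k, k + m)) :
  row_free (col_mx Y (Y *m A)) -> exists2 B, sim A B & row_free (ursubmx B).
Proof.
move=> rY.
have [|C gu] := @row_free_complete F k m Y.
  apply: row_free_ker => v vY.
  have : row_mx v 0 *m col_mx Y (Y *m A) = 0 *m col_mx Y (Y *m A).
    by rewrite mul_row_col vY !mul0mx addr0.
  by move/(row_free_inj rY); rewrite -(row_mx0 _ 1 k k) => /eq_row_mx[].
set g := col_mx Y C in gu; pose B := g *m A *m invmx g.
have sB : g *m A = B *m g by rewrite /B mulmxKV.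
exists B; first by exists g.
apply: row_free_ker => v vB.
have eYA : Y *m A = ulsubmx B *m Y + ursubmx B *m C.
  move: sB; rewrite /g mul_col_mx -[B]submxK mul_block_col => /eq_col_mx[-> _].
  by rewrite submxK.
have : row_mx (- (v *m ulsubmx B)) v *m col_mx Y (Y *m A) = 0 *m col_mx Y (Y *m
  A).
  rewrite mul_row_col eYA mulmxDr (mulmxA v (ursubmx B)) vB !mul0mx addr0.
  by rewrite mulNmx mulmxA addNr.
by move/(row_free_inj rY); rewrite -(row_mx0 _ 1 k k) => /eq_row_mx[].
Qed.

(** Conjugation by a lower unitriangular matrix with block [a] subtracts [ursubmx A *m a] from the
    corner, which can reach any value because [ursubmx A] has a right inverse. It adds
    [a *m ursubmx A] to the lower right block. *)
Lemma sim_corner F k m (A : 'M[F]_(k + m)) (T : 'M[F]_k) :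
  row_free (ursubmx A) ->
  exists B, [/\ sim A B, ulsubmx B = T &
                (0 < k < m)%N -> ~~ is_scalar_mx (drsubmx B)].
Proof.
move=> rA; have [R eR] := row_freeP rA.
have conj a : ursubmx A *m a = ulsubmx A - T ->
    exists B, [/\ sim A B, ulsubmx B = T & drsubmx B = drsubmx A + a *m ursubmx
      A].
  move=> ea; set D := drsubmx A + _.
  exists (block_mx T (ursubmx A) (dlsubmx A + a *m ulsubmx A - D *m a) D).
  split; [|by rewrite block_mxKul|by rewrite block_mxKdr].
  exists (block_mx 1%:M 0 a 1%:M); first by rewrite unitmxE det_lblock !det1
    mulr1 unitr1.
  rewrite -{1}[A]submxK !mulmx_block !(mul0mx, mulmx0, mul1mx, mulmx1, addr0,
    add0r).
  by rewrite ea (addrC T) !subrK /D [_ + dlsubmx A]addrC [_ + drsubmx A]addrC.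
pose a0 := R *m (ulsubmx A - T).
have ea0 : ursubmx A *m a0 = ulsubmx A - T by rewrite mulmxA eR mul1mx.
have [B0 [sB0 B0T B0D]] := conj _ ea0.
have [/is_scalar_mxP[s es]|] := boolP (is_scalar_mx (drsubmx B0)); last first.
  by exists B0.
have [/andP[k0 km]|] := boolP (0 < k < m)%N; last by exists B0; split.
have [i [j nz]] : exists i j, cokermx (ursubmx A) i j != 0.
  apply/matrix0Pn; rewrite -mxrank_eq0 mxrank_coker subn_eq0 -ltnNge.
  exact: leq_ltn_trans (rank_leq_row _) km.
(* A nonzero [a'] killed by [ursubmx A] exists because [k < m]. It does not affect the corner, and
   it changes the lower right block by a nonzero matrix of square zero, which is not scalar. *)
pose a' : 'M[F]_(m, k) := col j (cokermx (ursubmx A)) *m const_mx 1.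
have a'0 : a' != 0.
  apply/matrix0Pn; exists i, (Ordinal k0); rewrite mxE big_ord1.
  by rewrite [const_mx _ _ _]mxE mulr1 [X in X != 0]mxE.
have ua' : ursubmx A *m a' = 0.
  by rewrite mulmxA colE (mulmxA _ (cokermx _)) mulmx_coker !mul0mx.
have [|B [sB BT BD]] := conj (a0 + a'); first by rewrite mulmxDr ua' addr0.
exists B; split=> // _; apply/is_scalar_mxP => -[t]; rewrite BD mulmxDl addrA
  -B0D es.
move/(canRL (addKr _)); rewrite -raddfN -raddfD /= => e.
have c0 : - s + t = 0.
  have: a' *m ursubmx A *m (a' *m ursubmx A) = 0.
    by rewrite -mulmxA (mulmxA _ a') ua' mul0mx mulmx0.
  rewrite e -scalar_mxM => /matrixP/(_ i i)/eqP.
  by rewrite !mxE eqxx mulf_eq0 orbb => /eqP.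
case/eqP: a'0; apply: (row_free_inj rA).
by rewrite e c0 raddf0 mul0mx.
Qed.

Lemma sim_drsubmx F k m (A : 'M[F]_(k + m)) (D : 'M[F]_m) :
  sim (drsubmx A) D ->
  exists B, [/\ sim A B, ulsubmx B = ulsubmx A & drsubmx B = D].
Proof.
case=> g gu e.
exists (block_mx (ulsubmx A) (ursubmx A *m invmx g) (g *m dlsubmx A) D).
split; [|by rewrite block_mxKul|by rewrite block_mxKdr].
exists (block_mx 1%:M 0 0 g); first by rewrite block_diag_mx_unit unitmx1.
rewrite -{1}[A]submxK !mulmx_block !(mul0mx, mulmx0, mul1mx, mulmx1, addr0,
  add0r).
by rewrite mulmxKV // e.
Qed.

(** The diagonal is filled one entry at a time, with the remaining block kept nonscalar. *)
Lemma fillmore F n (A : 'M[F]_n) (d : 'I_n -> F) :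
  ~~ is_scalar_mx A -> \sum_i d i = \tr A ->
  exists2 B, sim A B & forall i, B i i = d i.
Proof.
elim: n A d => [|n IH] A d nA trA.
  by case/negP: nA; apply/is_scalar_mxP; exists 0; apply/matrixP=> -[].
have [x rx] := nonscalar_vector nA.
have [B0 sB0 rB0] := @sim_ur_row_free F 1 n A x rx.
have [B1 [sB1 B1d nB1]] := sim_corner (d 0)%:M rB0.
have sAB1 := sim_trans sB0 sB1.
have trB1 : \sum_(i < n) d (lift ord0 i) = \tr (drsubmx B1).
  move: trA; rewrite (mxtrace_sim sAB1) -[B1 in RHS](@submxK _ 1 n 1 n).
  by rewrite mxtrace_block B1d big_ord_recl mxtrace_scalar mulr1n => /addrI.
suff [B2 [sB2 ul2 dr2]] : exists B2, [/\ sim B1 B2, ulsubmx B2 = ulsubmx B1 &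
    forall i, drsubmx B2 i i = d (lift ord0 i)].
  exists B2; first exact: sim_trans sB2.
  move=> i; rewrite -(@splitK 1 n i); case: split => j /=.
    transitivity (ulsubmx B2 j j); first by rewrite !mxE.
    by rewrite ul2 B1d mxE eqxx; congr d; apply: val_inj; rewrite [j]ord1.
  transitivity (drsubmx B2 j j); first by rewrite !mxE.
  by rewrite dr2; congr d; apply: val_inj.
(* A remaining block of size at most 1 is necessarily scalar, but there the trace already forces the
   last entry. *)
case: (ltnP 1 n) => n1.
  have [D sD dD] := IH _ (fun i => d (lift ord0 i)) (nB1 n1) trB1.
  have [B2 [? ? e]] := sim_drsubmx sD.
  by exists B2; split=> // i; rewrite e.
exists B1; split=> //; first exact: sim_refl.
move: trB1 n1; clear; case: n B1 d => [|[|n]] B1 d; first by move=> _ _ [].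
  by rewrite big_ord1 /mxtrace big_ord1 => e _ i; rewrite ord1.
by [].
Qed.

Lemma sum4_nonscalar F n (A : 'M[F]_n) :
  ~~ is_scalar_mx A -> \tr A = 2%:R *+ n -> sum4 A.
Proof.
move=> nA trA.
have [|B sB dB] := @fillmore F n A (fun=> 1 + 1) nA.
  by rewrite sumr_const card_ord trA.
apply: sum4_sim (sim_sym sB) _; rewrite (eq_lower_upper dB).
exists (1%:M + lower_part B), (1%:M + (lower_part B^T)^T).
by split=> //; apply: sum2_unipotent; [apply: nilmx_lower_part|apply:
  nilmx_upper_part].
Qed.

(** * Splitting off a scalar block *)

(* The pairing of the left and right kernels of [A - lambda] has rank at least
   [m], because each of them has codimension at most [s / 2]. *)
Lemma sim_split_scalar F m s (A : 'M[F]_(m + s)) (lam : F) :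
  (2 * \rank (A - lam%:M)%R <= s)%N ->
  exists2 B : 'M[F]_s, sim A (block_mx lam%:M 0 0 B)
    & \rank (B - lam%:M) = \rank (A - lam%:M).
Proof.
set N := A - _ => rN.
have [L [R [LN NR LR]]] : exists (L : 'M[F]_(m, m + s)) (R : 'M[F]_(m + s, m)),
    [/\ L *m N = 0, N *m R = 0 & L *m R = 1%:M].
  pose K := kermx N; pose K' := cokermx N.
  have rP : (m <= \rank (K *m K'))%N.
    apply: leq_trans (mxrank_mul_min _ _); rewrite mxrank_ker mxrank_coker.
    by move: rN; lia.
  pose P := K *m K'.
  pose L0 : 'M[F]_(m, m + s) := pid_mx m *m invmx (col_ebase P).
  pose R0 : 'M[F]_(m + s, m) := invmx (row_ebase P) *m pid_mx m.
  exists (L0 *m K), (K' *m R0); split.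
  - by rewrite -mulmxA mulmx_ker mulmx0.
  - by rewrite mulmxA mulmx_coker mul0mx.
  rewrite mulmxA -(mulmxA L0) -/P -(mulmx_ebase P) /L0 /R0 !mulmxA.
  rewrite mulmxKV ?col_ebase_unit // mulmxK ?row_ebase_unit //.
  by rewrite !mul_pid_mx -pid_mx_1; congr pid_mx; move: rP; rewrite -/P; lia.
have [|C hu] := @row_free_complete F m s L.
  by apply/row_freeP; exists R.
(* The corrected complement is annihilated by [R], and so is [K *m N]; hence [K *m N] has no
   component along [L], and the off-diagonal block vanishes. *)
pose K := C - C *m R *m L.
have KR : K *m R = 0 by rewrite mulmxBl -!mulmxA LR mulmx1 subrr.
have gu : col_mx L K \in unitmx.
  have -> : col_mx L K = block_mx 1%:M 0 (- (C *m R)) 1%:M *m col_mx L C.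
    by rewrite mul_block_col !mul1mx mul0mx addr0 mulNmx addrC.
  by rewrite unitmx_mul hu unitmxE det_lblock !det1 mulr1 unitr1.
set g := col_mx L K in gu.
pose E := K *m N *m invmx g.
have eE : K *m N = lsubmx E *m L + rsubmx E *m K.
  by rewrite -mul_row_col hsubmxK mulmxKV.
have E0 : lsubmx E = 0.
  have: K *m N *m R = 0 by rewrite -mulmxA NR mulmx0.
  by rewrite eE mulmxDl -!mulmxA LR KR mulmx0 addr0 mulmx1.
have sN : g *m N = block_mx 0 0 0 (rsubmx E) *m g.
  by rewrite mul_col_mx mul_block_col LN eE E0 !mul0mx !add0r.
exists (lam%:M + rsubmx E).
  exists g => //; have -> : A = lam%:M + N by rewrite addrC subrK.
  rewrite mulmxDr sN scalar_mxC -mulmxDl; congr (_ *m _).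
  by rewrite scalar_mx_block add_block_mx !addr0.
rewrite addrC addKr; transitivity (\rank (g *m N)).
  by rewrite sN mxrankMfree ?row_free_unit // rank_diag_block_mx mxrank0.
by rewrite (eqmxMfull N) // row_full_unit.
Qed.

(** * Scalar matrices *)

Lemma sum2_0 F n : sum2 (0 : 'M[F]_n).
Proof. by exists 0, 0; rewrite mulmx0 addr0. Qed.

Lemma sum2_1 F n : sum2 (1%:M : 'M[F]_n).
Proof. by exists 1%:M, 0; rewrite mulmx0 mulmx1 addr0. Qed.

Lemma sum2_2 F n : sum2 (2%:R%:M : 'M[F]_n).
Proof. by exists 1%:M, 1%:M; rewrite mulmx1 -raddfD. Qed.

(** [P e] has trace 1, and determinant 0 when [e ^+ 2 = 1], hence is idempotent by Cayley-Hamilton;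
    the off-diagonal entries of [P 1] and [P (- 1)] cancel. *)
Lemma sum2_opposite_pair F (y : F) : 2%:R != 0 :> F ->
  sum2 (block_mx (1 + y)%:M 0 0 (1 - y)%:M : 'M[F]_(1 + 1)).
Proof.
move=> nz2.
pose P (e : F) : 'M[F]_(1 + 1) := block_mx ((1 + y) / 2%:R)%:M
  (e * (1 - y ^+ 2) / 4%:R)%:M e%:M ((1 - y) / 2%:R)%:M.
have nz4 : 4%:R != 0 :> F by rewrite (natrM _ 2 2) mulf_neq0.
have P2 e : e * e = 1 -> P e *m P e = P e.
  move=> e1; rewrite mulmx_block -!scalar_mxM -!raddfD /=.
  by congr block_mx; congr scalar_mx; field: e1; rewrite ?nz2 ?nz4.
exists (P 1), (P (- 1)); split; [by apply: P2; ring|by apply: P2; ring|].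
rewrite add_block_mx -!raddfD /= -[0 in LHS](raddf0 (@scalar_mx F 1)).
by congr block_mx; congr scalar_mx; field; rewrite ?nz2 ?nz4.
Qed.

(* With [mu = lambda - 2], the scalar matrix [lambda] is written as
   [(1 + X') + (1 + Y)], where the eigenvalues of [X'] and [Y] are chained as
   [0], [mu], [-mu], [2 mu], [-2 mu], ...: all of them are matched with their
   opposites except the last one, [t.+1 mu], in [X']. *)
Lemma opposite_chain F (mu : F) t : 2%:R != 0 :> F ->
  exists (X : 'M[F]_t) (Y : 'M[F]_(1 + t)),
    [/\ sum2 (1%:M + X), sum2 (1%:M + Y) &
        block_mx (t.+1%:R * mu)%:M 0 0 X + Y = mu%:M].
Proof.
move=> nz2; elim: t => [|t [X [Y [sX sY e]]]].
  exists 0, 0; split; rewrite ?addr0; [exact: sum2_1|exact: sum2_1|].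
  rewrite mul1r [RHS](@scalar_mx_block _ 1 0); congr block_mx.
  by apply/matrixP=> -[].
pose c := t.+1%:R * mu.
pose Z : 'M[F]_(1 + t) := block_mx c%:M 0 0 X.
(* The two matrices exchange roles: the unmatched [c] joins the second one, where it is paired with
   [- c]. *)
exists Y, (block_mx (- c)%:M 0 0 (Z : 'M_t.+1)); split=> //.
  have eZ : 1%:M + Z = block_mx (1 + c)%:M 0 0 (1%:M + X).
    by rewrite (@scalar_mx_block _ 1 t) add_block_mx !addr0 -raddfD.
  rewrite (@scalar_mx_block _ 1 t.+1) add_block_mx !addr0 -raddfD /= eZ.
  have := @sum2_opposite_pair F (- c) nz2; rewrite opprK => sc.
  exact: (sum2_blockA sc sX).
rewrite add_block_mx !addr0 -raddfD /= (addrC Y).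
rewrite -/c -/Z in e; rewrite e [RHS](@scalar_mx_block _ 1 t.+1);
by congr (block_mx _%:M _ _ _); rewrite /c; ring.
Qed.

(** The unmatched end of the chain contributes the eigenvalue [1 + t.+1 * mu], here 2 or 0, which is
    a sum of two idempotents by itself. *)
Lemma sum4_scalar_period F (mu : F) t : 2%:R != 0 :> F ->
  t.+1%:R * mu = 1 \/ t.+1%:R * mu = -1 ->
  sum4 ((2%:R + mu)%:M : 'M[F]_t.+1).
Proof.
move=> nz2 emu; have [X [Y [sX sY e]]] := opposite_chain mu t nz2.
exists (1%:M + (block_mx (t.+1%:R * mu)%:M 0 0 X : 'M_(1 + t))), (1%:M + Y).
split=> //.
  rewrite (@scalar_mx_block _ 1 t) add_block_mx !addr0 -raddfD /=.
  suff s1 : sum2 ((1 + t.+1%:R * mu)%:M : 'M_1) by exact: (sum2_block s1 sX).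
  case: emu => ->; first exact: sum2_2.
  by rewrite subrr raddf0; apply: sum2_0.
by rewrite addrACA e -!raddfD.
Qed.

Lemma sum4_scalarD F (lam : F) m n :
  sum4 (lam%:M : 'M[F]_m) -> sum4 (lam%:M : 'M[F]_n) ->
  sum4 (lam%:M : 'M[F]_(m + n)).
Proof. by move=> sm sn; rewrite scalar_mx_block; apply: sum4_block. Qed.

Lemma sum4_scalarM F (lam : F) m k :
  sum4 (lam%:M : 'M[F]_m) -> sum4 (lam%:M : 'M[F]_(k * m)).
Proof.
move=> sm; elim: k => [|k IH]; last by rewrite mulSn; apply: sum4_scalarD.
by exists 0, 0; split; [exact: sum2_0|exact: sum2_0|apply/matrixP=> -[]].
Qed.

Lemma coprime_combination a b n : (0 < a)%N -> coprime a b -> (a * b <= n)%N ->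
  exists x y, n = (x * a + y * b)%N.
Proof.
move=> a0 /eqP cab abn; have [u ua] := Bezoutl b a0; rewrite cab => du.
(* Since [u * b] is -1 modulo [a], the product [y * b] is congruent to [n]; reducing [y] modulo [a]
   keeps it below the bound [a * b]. *)
pose y := ((a - u) * n %% a)%N.
have yb : (y * b <= n)%N.
  by apply: leq_trans abn; rewrite leq_mul2r ltnW ?orbT // ltn_pmod.
exists ((n - y * b) %/ a)%N, y; rewrite divnK ?subnK //.
rewrite -eqn_mod_dvd // /y modnMml -mulnA -(eqn_modDr (u * (n * b))).
rewrite -mulnDl subnK ?(ltnW ua) // modnMr.
have -> : (n + u * (n * b) = (1 + u * b) * n)%N by ring.
exact: dvdn_mulr.
Qed.

(** For odd [p] and nonzero [mu], the chain closes at the sizes [t] and [p - t], where [t]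
    represents the inverse of [mu]. These are coprime because their sum is prime, so they generate
    all sizes from [p * p] on. *)
Lemma sum4_scalar_Fp p (lam : 'F_p) n : prime p -> (p * p <= n)%N ->
  sum4 (lam%:M : 'M['F_p]_n).
Proof.
move=> pp pn; pose mu := lam - 2%:R.
have -> : lam = 2%:R + mu by rewrite addrC subrK.
have [->|mu0] := eqVneq mu 0.
  by exists 1%:M, 1%:M; rewrite addr0 -raddfD; split=> //; apply: sum2_1.
have [p2|p2] := eqVneq p 2%N.
  have -> : 2%:R + mu = 1.
    subst p; rewrite (pchar_Fp_0 pp) add0r; apply: val_inj.
    by move: mu mu0; case=> -[|[|]].
  by exists 1%:M, 0; rewrite addr0; split=> //; [apply: sum2_1|apply: sum2_0].
have nz2 : 2%:R != 0 :> 'F_p.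
  rewrite -(dvdn_pcharf (pchar_Fp pp)) dvdn_prime2 //.
pose t := (mu^-1 : 'F_p) : nat.
have et : t%:R * mu = 1 by rewrite natr_Zp mulVf.
have t0 : (0 < t)%N by rewrite lt0n; apply: contra_eq_neq et => ->; rewrite
  mul0r eq_sym oner_eq0.
have tp : (t < p)%N by rewrite -[X in (_ < X)%N](Fp_cast pp) ltn_ord.
have s1 : sum4 ((2%:R + mu)%:M : 'M_t).
  by case: t et t0 {tp} => // t et _; apply: sum4_scalar_period => //; left.
have s2 : sum4 ((2%:R + mu)%:M : 'M_(p - t)).
  have : (p - t)%:R * mu = - 1.
    by rewrite natrB ?(ltnW tp) // pchar_Fp_0 // sub0r mulNr et.
  have : (0 < p - t)%N by rewrite subn_gt0.
  by case: (p - t)%N => // u _ eu; apply: sum4_scalar_period => //; right.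
have [||x [y ->]] := @coprime_combination t (p - t) n t0.
- by rewrite /coprime -gcdnDl subnKC ?(ltnW tp) // -/(coprime _ _) coprime_sym
    prime_coprime // gtnNdvd.
- by apply: leq_trans pn; apply: leq_mul; rewrite ?leq_subr // ltnW.
by apply: sum4_scalarD; apply: sum4_scalarM.
Qed.

(** * Compensating the eigenvalue 2 *)

Lemma sim_split_21 F j m (N : 'M[F]_j) (Z : 'M[F]_(m, j)) (N' : 'M[F]_m) :
  nilmx N -> nilmx N' ->
  sim (block_mx (2%:R%:M + N) 0 Z (1%:M + N'))
      (block_mx (2%:R%:M + N) 0 0 (1%:M + N')).
Proof.
move=> nN nN'; apply: sim_ltriangle.
(* Shifting both diagonal blocks by 2 leaves the Sylvester equation unchanged and turns the
   eigenvalues 1 and 2 into -1 and 0. *)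
have [|Y eY] := @sylvester_nilmx F m j ((-1)%:M + N') N Z _ nN.
  by apply: unitmx_scalar_nil; rewrite ?oppr_eq0 ?oner_eq0.
exists Y; have -> : 1%:M + N' = 2%:R%:M + ((-1)%:M + N').
  by rewrite addrA -raddfD; congr (_%:M + _); ring.
by rewrite mulmxDl mulmxDr -scalar_mxC opprD addrACA subrr add0r.
Qed.

Lemma strictly_lower_drsubmx F k m (N : 'M[F]_(k + m)) : strictly_lower N ->
  strictly_lower (drsubmx N).
Proof. by move=> sN i j ij; rewrite !mxE sN //= leq_add2l. Qed.

(** For all [C] and [D], the block matrix with rows [2, C] and [D, 0] is a sum of two idempotents. A
    suitable choice is similar to a block triangular matrix with diagonal blocks [2 + N] and
    [- drsubmx N], and the distinct eigenvalues 2 and 0 then allow [C] to be removed. *)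
Lemma sum2_shrink F k (N : 'M[F]_(1 + k)) :
  strictly_lower N -> 2%:R != 0 :> F \/ k = 0%N ->
  sum2 (block_mx (2%:R%:M + N) 0 0 (- drsubmx N)).
Proof.
move=> sN hk.
(* The first row of [N] is zero, so [- N] factors as [C *m K] through size [k]; the reversed product
   [K *m C] is [- N] without its first row and column. *)
pose C : 'M[F]_(1 + k, k) := - col_mx 0 1%:M.
pose K : 'M[F]_(k, 1 + k) := dsubmx N.
pose D := K *m C *m K - 2%:R *: K.
have CK : C *m K = - N.
  rewrite mulNmx mul_col_mx mul0mx mul1mx; congr (- _); rewrite -[RHS]vsubmxK.
  by congr col_mx; apply/matrixP=> i j; rewrite !mxE sN // [i]ord1.
have KC : K *m C = - drsubmx N.
  by rewrite mulmxN -[K]hsubmxK mul_row_col mulmx0 mulmx1 add0r /K -[N in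
    LHS]submxK block_mxEv col_mxKd row_mxKr.
have s2 : sum2 (block_mx 2%:R%:M C D 0).
  exists (block_mx 1%:M C 0 0), (block_mx 1%:M 0 D 0).
  split; rewrite ?mulmx_block ?add_block_mx;
    rewrite ?(mulmx0, mul0mx, mulmx1, mul1mx, addr0, add0r) //.
  by rewrite -raddfD.
have s3 : sum2 (block_mx (2%:R%:M + N) C 0 (- drsubmx N)).
  apply: sum2_sim s2; exists (block_mx 1%:M 0 K 1%:M).
    by rewrite unitmxE det_lblock !det1 mulr1 unitr1.
  rewrite !mulmx_block !(mulmx0, mul0mx, mulmx1, mul1mx, addr0, add0r) CK -KC.
  by rewrite addrK mul_mx_scalar /D addrC subrK.
apply: sum2_sim s3; apply: sim_utriangle; case: hk => [nz2|k0].
  apply: sylvester_nilmx; last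
    exact/nilmxN/strictly_lower_nilmx/strictly_lower_drsubmx.
  exact/unitmx_scalar_nil/strictly_lower_nilmx.
by clear -k0; subst k; exists 0; apply/matrixP=> ? -[].
Qed.

(** The number [k (k - 1) / 2], total size of compensating blocks of sizes [k - 1], ..., 1, 0. The
    recursion follows the nesting of these blocks, so that no casts are needed. *)
Fixpoint tri k := if k is k'.+1 then (k' + tri k')%N else 0%N.

Lemma leq_tri k : (tri k <= k * k)%N.
Proof. by elim: k => //= k IH; lia. Qed.

(* [2 + N] alone need not be a sum of two idempotents, because of the excess of
   the eigenvalue 2 over the eigenvalue 0. The summand [1 + Y] compensates it
   with the eigenvalues 0, 2, 0, ... in Jordan blocks of sizes decreasing by
   one, and the opposite [1 - Y] is compensated in the same way. *)
Lemma sum2_compensation F k (N : 'M[F]_k) :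
  strictly_lower N -> 2%:R != 0 :> F \/ (k <= 1)%N ->
  exists Y : 'M[F]_(tri k),
    sum2 (block_mx (2%:R%:M + N) 0 0 (1%:M + Y)) /\ sum2 (1%:M - Y).
Proof.
elim: k N => [|k IH] N sN hk.
  exists 0; rewrite subr0 addr0 (_ : N = 0); last by apply/matrixP=> -[].
  rewrite addr0; split; last exact: sum2_1.
  by apply: sum2_block; [exact: sum2_2|exact: sum2_1].
have [||Y [sY1 sY2]] := IH (drsubmx (N : 'M_(1 + k))).
- exact: strictly_lower_drsubmx.
- by case: hk; [left|right; apply: leq_trans (leqnSn _) _].
set N' := drsubmx _ in sY1.
(* With this witness [1 + Y] starts with the block [- N'] that [2 + N] requires, while its opposite
   [1 - Y] starts with [2 + N'], which the induction hypothesis compensates. *)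
exists (block_mx (- (1%:M + N')) 0 0 (- Y)).
rewrite scalar_mx_block opp_block_mx !oppr0 !opprK !add_block_mx !addr0.
rewrite opprD addrA subrr sub0r; split.
  apply: sum2_blockA sY2; apply: (@sum2_shrink F k N) => //.
  by case: hk; [left|rewrite ltnS leqn0 => /eqP; right].
by rewrite addrA -raddfD.
Qed.

(** * Matrices far from every scalar matrix *)

Lemma independent_images F n j (A : 'M[F]_n) :
  (forall lam, 4 * j <= \rank (A - lam%:M)%R)%N ->
  exists Y : 'M[F]_(j, n), row_free (col_mx Y (Y *m A)).
Proof.
move=> rA; suff: forall i, (i <= j)%N ->
  exists Y : 'M[F]_(i, n), row_free (col_mx Y (Y *m A)) by apply.
elim=> [|i IH] ij.
  by exists 0; apply: row_free_ker => v _; apply/rowP=> -[].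
have [Y rY] := IH (ltnW ij).
have [m en] : exists m, n = (i + i + m)%N.
  exists (n - (i + i))%N; rewrite subnKC //.
  have := leq_trans (rA 0) (rank_leq_row _); lia.
subst n; have [C gu] := row_free_complete rY.
set U := col_mx Y _ in rY gu; set g := col_mx U C in gu.
(* [pi] reads off the coordinates along [C]: it kills [Y] and [Y *m A]. Hence [X] below is the
   compression of [A] to the complement [C]. *)
pose pi := rsubmx (invmx g).
have /esym := mulmxV gu; rewrite {1}/g mul_col_mx scalar_mx_block -[invmx
  g]hsubmxK.
rewrite !mul_mx_row block_mxEv => /eq_col_mx[/eq_row_mx[_ /esym Upi]
  /eq_row_mx[_ /esym Cpi]].
rewrite -/pi in Upi Cpi.
pose X := C *m A *m pi.
(* If [X] were the scalar [lam], then [A - lam] would send [C] into the span of the [i + i] rows of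
   [U], and its rank would be at most [4 * i]. *)
have nX : ~~ is_scalar_mx X.
  apply/is_scalar_mxP=> -[lam eX].
  have : (\rank (A - lam%:M)%R <= (i + i) + (i + i))%N; last first.
    by rewrite leqNgt; apply/negP/negPn; apply: leq_trans (rA lam); lia.
  have -> : \rank (A - lam%:M) = \rank (g *m (A - lam%:M)).
    by rewrite (eqmxMfull (A - lam%:M)) // row_full_unit.
  set E := C *m (A - lam%:M) *m invmx g.
  have eE : C *m (A - lam%:M) = lsubmx E *m U.
    rewrite -[LHS](mulmxKV gu) -/E -{1}[E]hsubmxK mul_row_col.
    suff -> : rsubmx E = 0 by rewrite mul0mx addr0.
    rewrite /E -[invmx g]hsubmxK mul_mx_row row_mxKr -/pi mulmxBr mulmxBl -/X
      eX.
    by rewrite mul_mx_scalar -scalemxAl Cpi scalemx1 subrr.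
  rewrite mul_col_mx eE -addsmxE; apply: leq_trans (mxrank_adds_leqif _ _) _.
  apply: leq_add; first exact: rank_leq_row.
  exact: leq_trans (mxrankM_maxr _ _) (rank_leq_row _).
have [x rx] := nonscalar_vector nX.
(* In a linear relation, applying [pi] isolates the coefficients of the new vector and of its image;
   the others vanish by the independence of [U]. *)
pose W : 'M_(1 + i, i + i + m) := col_mx (x *m C) Y.
suff rW : row_free (col_mx W (W *m A)) by exists W.
apply: row_free_ker => v; have [a [b [c [d ->]]]] : exists a b c d,
    v = row_mx (row_mx a b : 'rV_(1 + i)) (row_mx c d : 'rV_(1 + i)).
  exists (@lsubmx F 1 1 i (lsubmx v)), (@rsubmx F 1 1 i (lsubmx v)).
  exists (@lsubmx F 1 1 i (rsubmx v)), (@rsubmx F 1 1 i (rsubmx v)).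
  by rewrite !hsubmxK.
rewrite /W mul_col_mx mul_row_col !mul_row_col => e.
have Ypi : Y *m pi = 0 /\ Y *m A *m pi = 0.
  by move: Upi; rewrite mul_col_mx -[0]col_mx0 => /eq_col_mx.
have : row_mx a c *m col_mx x (x *m X) = 0 *m col_mx x (x *m X).
  rewrite mul0mx -[RHS](mul0mx _ pi) -e !mulmxDl mul_row_col -!mulmxA.
  by rewrite Ypi.1 Cpi mulmx1 (mulmxA Y) Ypi.2 !mulmx0 !addr0 /X !mulmxA.
move/(row_free_inj rx); rewrite -[0](row_mx0 _ 1 1 1) => /eq_row_mx[a0 c0].
have : row_mx b d *m U = 0 *m U.
  by rewrite mul0mx mul_row_col -e a0 c0 !mul0mx !add0r.
move/(row_free_inj rY); rewrite -[0](row_mx0 _ 1 i i) => /eq_row_mx[b0 d0].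
by rewrite a0 b0 c0 d0 !row_mx0.
Qed.

Lemma sum4_far_from_scalar F n j (A : 'M[F]_n) :
  (0 < j)%N -> (forall lam, 4 * j <= \rank (A - lam%:M)%R)%N ->
  \tr A = 2%:R *+ n + j%:R -> sum4 A.
Proof.
move=> j0 rA trA; have [Y rY] := independent_images rA.
have [m en] : exists m, n = (j + m)%N.
  by exists (n - j)%N; have := leq_trans (rA 0) (rank_leq_row _); lia.
have jm : (j < m)%N by have := leq_trans (rA 0) (rank_leq_row _); lia.
clear rA; subst n; have [B0 sB0 rB0] := sim_ur_row_free rY.
have [B1 [sB1 B1T nB1]] := sim_corner 3%:R%:M rB0.
have sAB1 := sim_trans sB0 sB1.
have [||D sD dD] := @fillmore F m (drsubmx B1) (fun=> 1 + 1).
- by apply: nB1; rewrite j0.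
- rewrite sumr_const card_ord; apply: (addrI (3%:R *+ j)).
  rewrite -[in RHS]mxtrace_scalar -B1T -(mxtrace_block _ (ursubmx B1) (dlsubmx
    B1)) submxK -(mxtrace_sim sAB1) trA.
  by rewrite mulrnDr; ring.
have [B2 [sB2 B2T B2D]] := sim_drsubmx sD.
apply: sum4_sim (sim_sym (sim_trans sAB1 sB2)) _.
(* The corner 3 is split as 2 + 1: the eigenvalue 2 occurs only as a scalar block in the first
   summand, and the second summand is unipotent. *)
have -> : B2 = block_mx 2%:R%:M 0 (dlsubmx B2) (1%:M + lower_part D) +
               (1%:M + block_mx 0 (ursubmx B2) 0 (lower_part D^T)^T).
  rewrite scalar_mx_block !add_block_mx -[LHS]submxK B2D B2T B1T.
  by rewrite !(addr0, add0r) -raddfD -(natrD F 2 1) -(eq_lower_upper dD).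
do 2 eexists; split; last by [].
  have := @sim_split_21 F j m 0 (dlsubmx B2) (lower_part D); rewrite addr0 => s.
  apply: sum2_sim (sim_sym (s _ _)) _; [by exists 1%N; rewrite expr1|exact:
    nilmx_lower_part|].
  by apply: sum2_block; [exact: sum2_2|exact/sum2_unipotent/nilmx_lower_part].
apply/sum2_unipotent/nilmx_block; last exact: nilmx_upper_part.
by exists 1%N; rewrite expr1.
Qed.

(** * Matrices near a scalar matrix *)

Lemma split_scalar_nonscalar F n s (A : 'M[F]_n) (B : 'M[F]_s) (lam : F) :
  ~~ is_scalar_mx A -> \rank (B - lam%:M) = \rank (A - lam%:M) ->
  (2 * \rank (A - lam%:M)%R <= s)%N -> ~~ is_scalar_mx B.
Proof.
move=> nA rAB r2; apply/is_scalar_mxP=> -[mu eB].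
have rA : \rank (A - lam%:M) != 0%N.
  apply: contra nA; rewrite mxrank_eq0 subr_eq0 => /eqP ->.
  exact: scalar_mx_is_scalar.
move: rAB; rewrite eB -raddfB /=; have [->|ne] := eqVneq mu lam.
  by rewrite subrr raddf0 mxrank0 => e; rewrite -e in rA.
rewrite -scalemx1 mxrank_scale_nz ?subr_eq0 // mxrank1 => e.
by move: r2 rA; rewrite -e; lia.
Qed.

Lemma sum4_near_scalar_neq2 p n (A : 'M['F_p]_n) (lam : 'F_p) :
  prime p -> lam != 2%:R -> ~~ is_scalar_mx A ->
  (2 * \rank (A - lam%:M)%R + p * p + p <= n)%N -> sum4 A.
Proof.
move=> pp lam2 nA; set r := \rank _ => rn.
(* Removing a block [lam] of size [m] leaves trace twice the remaining size exactly when
   [m (lam - 2) = \tr A - 2 n]. Adding [p * p] to the residue keeps this equation and makes [m]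
   large enough for the scalar case. *)
pose u : 'F_p := (\tr A - 2%:R *+ n) / (lam - 2%:R).
pose t : nat := u.
have tp : (t < p)%N by rewrite -[X in (_ < X)%N](Fp_cast pp) ltn_ord.
pose m := (p * p + t)%N.
have em : m%:R * (lam - 2%:R) = \tr A - 2%:R *+ n.
  rewrite /m natrD natrM pchar_Fp_0 // mul0r add0r natr_Zp divfK //.
  by rewrite subr_eq0.
have [s en] : exists s, n = (m + s)%N.
  by exists (n - m)%N; rewrite subnKC // /m; move: rn tp; lia.
have rs : (2 * r <= s)%N by move: rn tp; rewrite en /m; lia.
have pm : (p * p <= m)%N := leq_addr t _.
clearbody m t; clear rn; subst n; have [B sB rB] := sim_split_scalar rs.
have nB := split_scalar_nonscalar nA rB rs.
apply: sum4_sim (sim_sym sB) _; apply: sum4_block.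
  apply: sum4_scalar_Fp => //.
apply: sum4_nonscalar => //.
have := mxtrace_sim sB; rewrite mxtrace_block mxtrace_scalar => trA.
have eA : \tr A = m%:R * (lam - 2%:R) + 2%:R *+ (m + s) by rewrite em subrK.
apply: (addrI (lam *+ m)); rewrite -trA eA mulrnDr; ring.
Qed.

Lemma sum4_near_two p n (A : 'M['F_p]_n) :
  prime p -> ~~ is_scalar_mx A ->
  (2 * \rank (A - 2%:R%:M)%R + p * p + p <= n)%N -> sum4 A.
Proof.
move=> pp nA; set r := \rank _ => rn.
pose u : 'F_p := \tr A - 2%:R *+ n.
pose j : nat := u.
have jp : (j < p)%N by rewrite -[X in (_ < X)%N](Fp_cast pp) ltn_ord.
have ej : \tr A = 2%:R *+ n + j%:R by rewrite natr_Zp addrC subrK.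
have tj : (tri j <= p * p)%N.
  by apply: leq_trans (leq_tri j) _; rewrite leq_mul // ltnW.
(* In characteristic 2 the residue [j] is at most 1, and then [tri j = 0]: nothing needs
   compensating. *)
have hj : 2%:R != 0 :> 'F_p \/ (j <= 1)%N.
  have [p2|p2] := eqVneq p 2%N; first by right; rewrite -ltnS -p2.
  by left; rewrite -(dvdn_pcharf (pchar_Fp pp)) dvdn_prime2.
have [s en] : exists s, n = (tri j + (j + s))%N.
  by exists (n - tri j - j)%N; move: rn tj jp; lia.
have rs : (2 * r <= j + s)%N by move: rn tj; rewrite en; lia.
clearbody j; clear rn; subst n; have [B sB rB] := sim_split_scalar rs.
have nB := split_scalar_nonscalar nA rB rs.
(* After a block 2 of size [tri j] is removed, the trace still exceeds twice the size by [j]; this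
   excess is carried by [j] diagonal entries 3. *)
pose d (i : 'I_(j + s)) : 'F_p := if split i is inl _ then 2%:R + 1 else 1 + 1.
have [|D sD dD] := @fillmore _ _ B d nB.
  rewrite big_split_ord /=.
  rewrite (eq_bigr (fun=> 2%:R + 1)) => [|i _]; last first.
    by rewrite /d -[lshift _ _]/(unsplit (inl i)) unsplitK.
  rewrite [X in _ + X](eq_bigr (fun=> 1 + 1)) => [|i _]; last first.
    by rewrite /d -[rshift _ _]/(unsplit (inr i)) unsplitK.
  rewrite !sumr_const !card_ord; apply: (addrI (2%:R *+ tri j)).
  rewrite -[in RHS]mxtrace_scalar -(mxtrace_block _ 0 0) -(mxtrace_sim sB) ej.
  by rewrite !mulrnDr !mulrnDl; ring.
have dul i : ulsubmx D i i = 2%:R + 1.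
  by rewrite !mxE dD /d -[lshift _ _]/(unsplit (inl i)) unsplitK.
have ddr i : drsubmx D i i = 1 + 1.
  by rewrite !mxE dD /d -[rshift _ _]/(unsplit (inr i)) unsplitK.
apply: sum4_sim (sim_sym (sim_trans sB (sim_block (sim_refl _) sD))) _.
set L1 := lower_part (ulsubmx D); set L2 := lower_part (drsubmx D).
set U1 := (lower_part (ulsubmx D)^T)^T; set U2 := (lower_part (drsubmx D)^T)^T.
have eD : D = block_mx (2%:R%:M + L1) 0 (dlsubmx D) (1%:M + L2) +
              (1%:M + block_mx U1 (ursubmx D) 0 U2).
  rewrite (@scalar_mx_block _ j s) !add_block_mx !(addr0, add0r).
  by rewrite -(eq_lower_upper dul) -(eq_lower_upper ddr) submxK.
have [Y [sY1 sY2]] := sum2_compensation (@strictly_lower_lower_part _ _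
  (ulsubmx D)) hj.
exists (block_mx (1%:M + Y) 0 0 (block_mx (2%:R%:M + L1) 0 (dlsubmx D) (1%:M +
  L2))).
exists (block_mx (1%:M - Y) 0 0 (1%:M + block_mx U1 (ursubmx D) 0 U2)); split.
- have s21 := sim_split_21 (dlsubmx D) (nilmx_lower_part (ulsubmx D))
    (nilmx_lower_part (drsubmx D)).
  apply: sum2_sim (sim_block (sim_refl _) (sim_sym s21)) _.
  by apply: sum2_blockA; [exact:
    sum2_blockC|exact/sum2_unipotent/nilmx_lower_part].
- by apply: sum2_block => //; apply/sum2_unipotent/nilmx_block; exact:
    nilmx_upper_part.
- rewrite add_block_mx -eD !addr0; congr block_mx.
  by rewrite addrACA subrr addr0 -raddfD.
Qed.

(** * All large matrices over the prime field *)

Lemma sum4_Fp p n (A : 'M['F_p]_n) :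
  prime p -> (8 * p + p * p + p <= n)%N -> sum4 A.
Proof.
move=> pp hn.
have [/is_scalar_mxP[lam ->]|nA] := boolP (is_scalar_mx A).
  by apply: sum4_scalar_Fp => //; move: hn; lia.
have [/existsP[lam rA]|/existsPn rA] :=
  (* Far from scalars, [4 * p] suffices because the excess can be represented by some [j <= p]. Near
     a scalar, twice the rank stays below [8 * p], which leaves room [p * p + p] for the scalar
     block. *)
  boolP [exists lam : 'F_p, (\rank (A - lam%:M)%R < 4 * p)%N].
  have rn : (2 * \rank (A - lam%:M)%R + p * p + p <= n)%N.
    by apply: leq_trans hn; rewrite !leq_add2r -(mulnA 2 4 p) leq_mul2l ltnW.
  have [e|ne] := eqVneq lam 2%:R; last exact: sum4_near_scalar_neq2 rn.
  by apply: sum4_near_two => //; rewrite -e.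
pose u : 'F_p := \tr A - 2%:R *+ n.
pose t : nat := u.
have tp : (t < p)%N by rewrite -[X in (_ < X)%N](Fp_cast pp) ltn_ord.
have et : \tr A = 2%:R *+ n + t%:R by rewrite natr_Zp addrC subrK.
(* The corner block must be nonempty, so the zero residue is represented by [p]. *)
have [j [j0 jp ej]] : exists j, [/\ (0 < j)%N, (j <= p)%N & j%:R = t%:R :>
  'F_p].
  have [->|t0] := posnP t; last by exists t; rewrite t0 ltnW.
  by exists p; rewrite prime_gt0 // pchar_Fp_0.
apply: (@sum4_far_from_scalar _ _ j) => // [lam|]; last by rewrite ej.
by rewrite (@leq_trans (4 * p)) ?leq_mul2l // leqNgt.
Qed.

Lemma sum_of_idempotents_sum4 F n (A : 'M[F]_n) :
  sum4 A -> sum_of_idempotents 4 A.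
Proof.
case=> B [C [[P [Q [P2 Q2 ->]]] [P' [Q' [P'2 Q'2 ->]]] ->]].
exists (fun i : 'I_4 => nth 0 [:: P; Q; P'; Q'] i); split.
  by case=> -[|[|[|[|]]]].
by rewrite !big_ord_recl big_ord0 addr0 /= !addrA.
Qed.

End SumsOfIdempotents.

Theorem theorem11 (p : nat) (hp : prime p) :
  exists n0 : nat, forall n : nat, n0 <= n ->
    forall A : 'M['F_p]_n, sum_of_idempotents 4 A.
Proof.
exists (8 * p + p * p + p) => n hn A.
exact/sum_of_idempotents_sum4/sum4_Fp.
Qed.
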